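(* Let $m,n \geq k \geq 1$ be integers, and let $A \in \mathbb{R}^{m \times n}$. The following statements are equivalent. (1) The matrix $A$ is totally positive of order $k$. (2) Every square submatrix of $A$ of size $r \leq k$ has the sign non-reversal property with respect to $\mathbb{R}^r$. (3) Every contiguous square submatrix of $A$ of size $r \leq k$ has the sign non-reversal property with respect to $\mathbb{R}^r_{\rm alt}$. (4) For every $r \in \{1,\dots,k\}$ and every contiguous $r \times r$ submatrix $B$ of $A$, setting $z^B := \det(B)\, \mathrm{adj}(B)\, d^{\langle r \rangle} \in \mathbb{R}^r$, the following two conditions hold: (i) $Bx \neq 0$ for all $x \in \mathbb{R}^r_{\rm alt}$; and (ii) $B$ has the non-strict sign non-reversal property with respect to $z^B$ (that is, with respect to the one-element set $\{z^B\}$).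
   Context: A real matrix is totally positive of order $k$ ($TP_k$) if all its minors of order (size) at most $k$ are positive. A submatrix is obtained by choosing a subset of the rows and a subset of the columns, kept in increasing order; it is contiguous if its rows and its columns are each indexed by a set of consecutive integers. For an integer $r \geq 1$: $d^{\langle r \rangle} := (1,-1,\dots,(-1)^{r-1})^T \in \mathbb{R}^r$. $\mathbb{R}^r_{\rm alt} \subset \mathbb{R}^r$ is the set of vectors all of whose components are nonzero and have alternating signs (consecutive components have opposite signs; for $r=1$, all nonzero reals). $\mathrm{adj}(B)$ is the adjugate matrix of the $r \times r$ matrix $B$ (for $r=1$, $\mathrm{adj}(B) = (1)$). Let $S \subseteq \mathbb{R}^r$. A matrix $B \in \mathbb{R}^{r \times r}$ has the sign non-reversal property with respect to $S$ if for every $0 \neq x \in S$ there is some $i \in \{1,\dots,r\}$ with $x_i (Bx)_i > 0$. It has the non-strict sign non-reversal property with respect to $S$ if for every $0 \neq x \in S$ there is some $i \in \{1,\dots,r\}$ with $x_i \neq 0$ and $x_i (Bx)_i \geq 0$. (In particular, the property with respect to $\{0\}$ holds vacuously.) *)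

(* Defs.v *)
From mathcomp Require Import all_boot all_order all_algebra.
From mathcomp Require Import classical_sets reals.

Set Implicit Arguments.
Unset Strict Implicit.
Unset Printing Implicit Defensive.

Import Order.TTheory GRing.Theory Num.Theory.

Local Open Scope ring_scope.

Definition submatrix (R : realType) (m n p q : nat)
    (A : 'M[R]_(m, n)) (B : 'M[R]_(p, q)) : Prop :=
  exists (f : 'I_p -> 'I_m) (g : 'I_q -> 'I_n),
    [/\ {homo f : i j / (i < j)%N}, {homo g : i j / (i < j)%N}
      & B = mxsub f g A].

Definition contiguous_submatrix (R : realType) (m n p q : nat)
    (A : 'M[R]_(m, n)) (B : 'M[R]_(p, q)) : Prop :=
  exists (f : 'I_p -> 'I_m) (g : 'I_q -> 'I_n),
    [/\ exists a : nat, forall i : 'I_p, f i = (a + i)%N :> nat,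
        exists b : nat, forall j : 'I_q, g j = (b + j)%N :> nat
      & B = mxsub f g A].

Definition totally_positive (R : realType) (m n k : nat)
    (A : 'M[R]_(m, n)) : Prop :=
  forall (r : nat) (B : 'M[R]_r),
    (1 <= r <= k)%N -> submatrix A B -> 0 < \det B.

(* d = (1, -1, ..., (-1)^(r-1))^T; the indices i : 'I_r start at 0. *)
Definition alt_vec (R : realType) (r : nat) : 'cV[R]_r :=
  \col_(i < r) (-1) ^+ i.

Definition R_alt (R : realType) (r : nat) : set 'cV[R]_r :=
  [set x | (forall i, x i 0 != 0) /\
           (forall i j : 'I_r, j = i.+1 :> nat -> x i 0 * x j 0 < 0)]%classic.
Arguments R_alt : clear implicits.

Definition sign_nonreversal (R : realType) (r : nat)
    (B : 'M[R]_r) (S : set 'cV[R]_r) : Prop :=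
  forall x : 'cV[R]_r, S x -> x != 0 ->
    exists i : 'I_r, 0 < x i 0 * (B *m x) i 0.

Definition nonstrict_sign_nonreversal (R : realType) (r : nat)
    (B : 'M[R]_r) (S : set 'cV[R]_r) : Prop :=
  forall x : 'cV[R]_r, S x -> x != 0 ->
    exists i : 'I_r, x i 0 != 0 /\ 0 <= x i 0 * (B *m x) i 0.

Definition zvec (R : realType) (r : nat) (B : 'M[R]_r) : 'cV[R]_r :=
  \det B *: (\adj B *m alt_vec R r).

(* Main.v *)
(* (1) => (2): square submatrices of size at most k are P-matrices, and if a
   P-matrix B reversed the signs of x then, on the support of x, (B + D) x = 0
   with D >= 0 diagonal, although det (B + D) > 0.  (3) => (4): if z^B violated
   (ii), a small perturbation of z^B along d would alternate strictly and still
   be sign-reversed.  (4) => (1): by induction on the size r, once the minors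
   of size r - 1 are positive adj(B) d alternates, so (i) gives det B <> 0 and
   (ii) gives det B > 0 for contiguous B; positivity spreads to all minors of
   size r by a three-term Pluecker relation (Fekete's criterion). *)

Require Import Defs.
From mathcomp Require Import all_boot all_order all_algebra.
From mathcomp Require Import classical_sets reals.
From mathcomp Require Import zify ring.

Set Implicit Arguments.
Unset Strict Implicit.
Unset Printing Implicit Defensive.

Import Order.TTheory GRing.Theory Num.Theory.

Local Open Scope ring_scope.

(** * Increasing index maps and insertion of an index *)

Lemma lift_homo n (i : 'I_n) : {homo lift i : j k / (j < k)%N}.
Proof. by move=> j k /=; rewrite /bump; lia. Qed.

Lemma lt_homo_inj p m (f : 'I_p -> 'I_m) :
  {homo f : i j / (i < j)%N} -> injective f.
Proof.
move=> hf i j eqf; apply/val_inj.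
by have [/hf|/hf|//] := ltngtP i j; rewrite eqf ltnn.
Qed.

(** Encoded through [unlift] so that composing with [lift s], which deletes position [s], gives back
    [f]. *)
Definition insert_at (T : Type) n (s : 'I_n.+1) (x : T) (f : 'I_n -> T)
    (i : 'I_n.+1) : T :=
  if unlift s i is Some k then f k else x.

Lemma insert_at_id T n (s : 'I_n.+1) (x : T) f : insert_at s x f s = x.
Proof. by rewrite /insert_at unlift_none. Qed.

Lemma insert_at_lift T n (s : 'I_n.+1) (x : T) f k :
  insert_at s x f (lift s k) = f k.
Proof. by rewrite /insert_at liftK. Qed.

Lemma insert_at_homo m n (s : 'I_n.+1) (x : 'I_m) (f : 'I_n -> 'I_m) :
  {homo f : i j / (i < j)%N} ->
  (forall k : 'I_n, (k < s)%N -> (f k < x)%N) ->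
  (forall k : 'I_n, (s <= k)%N -> (x < f k)%N) ->
  {homo insert_at s x f : i j / (i < j)%N}.
Proof.
move=> hf hl hr i j.
have [k ->|->] := unliftP s i; have [l ->|->] := unliftP s j;
  rewrite ?insert_at_id ?insert_at_lift ?ltnn // /lift /= /bump => h.
- by apply: hf; move: h; lia.
- by apply: hl; move: h; lia.
- by apply: hr; move: h; lia.
Qed.

(** * Determinant identities from Laplace expansion *)

Section Determinants.

Variable R : comNzRingType.

(** Put a copy of column [j] in front of [M]: the resulting square matrix [K] has a repeated column,
    and the sum is its expansion along the first one. *)
Lemma maximal_minors_left_kernel n (M : 'M[R]_(n.+1, n)) (j : 'I_n) :
  \sum_(i < _) (-1) ^+ i * \det (row' i M) * M i j = 0.
Proof.
pose K : 'M[R]_n.+1 := \matrix_(i, l) if unlift ord0 l is Some l' then M i l' else M i j.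
have : \det K = 0.
  rewrite -det_tr; apply: (@determinant_alternate _ _ _ ord0 (lift ord0 j)).
    exact: neq_lift.
  by move=> i; rewrite !mxE unlift_none liftK.
rewrite (expand_det_col _ ord0) => detK; rewrite -[RHS]detK; apply: eq_bigr => i _.
rewrite mxE unlift_none mulrC /cofactor addn0; congr (_ * (_ * \det _)).
by apply/matrixP => a b; rewrite !mxE liftK.
Qed.

(** Laplace expansion along the inserted row. The coefficients of the entries [A x j] depend on
    neither [x] nor [s], so one vector serves all insertions. *)
Lemma det_insert_at m n (A : 'M[R]_(m, n.+1)) (f : 'I_n -> 'I_m) s x :
  \det (rowsub (insert_at s x f) A) =
  (-1) ^+ s * \sum_(j < n.+1) A x j * ((-1) ^+ j * \det (col' j (rowsub f A))).
Proof.
rewrite (expand_det_row _ s) mulr_sumr; apply: eq_bigr => j _.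
rewrite mxE insert_at_id /cofactor exprD.
rewrite (_ : row' s _ = col' j (rowsub f A)); first by ring.
by apply/matrixP => a b; rewrite !mxE insert_at_lift.
Qed.

Lemma det_add_diag n (B : 'M[R]_n.+1) (j : 'I_n.+1) t :
  \det (B + t *: delta_mx j j) = \det B + t * \det (row' j (col' j B)).
Proof.
rewrite !(expand_det_row _ j) (bigD1 j) //= [in RHS](bigD1 j) //=.
rewrite !mxE !eqxx /= mulr1.
have cof l : cofactor (B + t *: delta_mx j j) j l = cofactor B j l.
  rewrite /cofactor; congr (_ * \det _); apply/matrixP => a b.
  by rewrite !mxE eq_sym (negbTE (neq_lift _ _)) mulr0 addr0.
rewrite cof [in LHS]mulrDl -!addrA; congr (_ + _).
rewrite addrC; congr (_ + _).
  apply: eq_bigr => l lj; rewrite cof !mxE eqxx (negbTE lj) /=.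
  by rewrite mulr0 addr0.
by rewrite /cofactor -signr_odd oddD addbb expr0 mul1r.
Qed.

End Determinants.

(** * Filling gaps in row sets by a Pluecker relation *)

Section Gap.

Variable R : realFieldType.

(* Pair the left kernel vector of [M] (its signed maximal minors) with the
   image under [N], which is [M] without its first column, of the vector
   orthogonal to the rows of [N] other than the first, the last and [s]:
   only these three rows contribute, and this is the Pluecker relation
   [C,s] [C,0,max] = [C,0] [C,s,max] + [C,max] [C,0,s]. *)
Lemma det_gap_gt0 q (M : 'M[R]_(q.+3, q.+2)) (t : 'I_q.+1) :
  (forall f : 'I_q.+1 -> 'I_q.+3, {homo f : i j / (i < j)%N} ->
     0 < \det (mxsub f (lift ord0) M)) ->
  0 < \det (row' ord0 M) -> 0 < \det (row' ord_max M) ->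
  0 < \det (row' (lift ord0 (lift ord_max t)) M).
Proof.
move=> minor_gt0 M0 Mmax; set s := lift ord0 _.
pose N := colsub (lift ord0) M.
pose C (k : 'I_q) : 'I_q.+3 := lift ord0 (lift ord_max (lift t k)).
have C_homo : {homo C : i j / (i < j)%N}.
  by move=> i j ij; do 3!apply: lift_homo.
pose w (j : 'I_q.+1) := (-1) ^+ j * \det (col' j (rowsub C N)).
pose Nw (i : 'I_q.+3) := \sum_j N i j * w j.
have rowsubN f : rowsub f N = mxsub f (lift ord0) M.
  by apply/matrixP => a b; rewrite !mxE.
(* The sign of [Nw x] is read off from the place [s'] that row [x] takes among the rows [C]. *)
have Nw_insert s' x : {homo insert_at s' x C : i j / (i < j)%N} ->
    0 < (-1) ^+ s' * Nw x.
  by move=> /minor_gt0; rewrite -rowsubN det_insert_at.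
have Nw0 : 0 < Nw ord0.
  have := @Nw_insert ord0 ord0; rewrite expr0 mul1r; apply.
  by apply: insert_at_homo.
have Nwmax : 0 < (-1) ^+ q * Nw ord_max.
  apply: (@Nw_insert ord_max ord_max); apply: insert_at_homo => // k.
    by move=> _; rewrite /= /bump; have := ltn_ord k; have := ltn_ord t; lia.
  by rewrite /= leqNgt ltn_ord.
have Nws : 0 < (-1) ^+ t * Nw s.
  apply: (@Nw_insert t s); apply: insert_at_homo => // k;
    by rewrite /= /bump; have := ltn_ord k; have := ltn_ord t; lia.
(* A row of [C] inserted once more, at position 0, gives a repeated row. *)
have NwC k : Nw (C k) = 0.
  rewrite -[LHS]mul1r -[1](expr0 (-1)) -[0%N]/(val (@ord0 q)) -det_insert_at.
  apply: (@determinant_alternate _ _ _ ord0 (lift ord0 k)).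
    exact: neq_lift.
  by move=> j; rewrite !mxE insert_at_id insert_at_lift.
have: \sum_(i < _) (-1) ^+ i * \det (row' i M) * Nw i = 0.
  transitivity (\sum_j (\sum_(i < _) (-1) ^+ i * \det (row' i M) * N i j) * w j).
    under [RHS]eq_bigr do rewrite mulr_suml.
    rewrite exchange_big /=; apply: eq_bigr => i _.
    by rewrite mulr_sumr; apply: eq_bigr => j _; rewrite mulrA.
  rewrite big1 // => j _.
  under eq_bigr do rewrite mxE.
  by rewrite maximal_minors_left_kernel mul0r.
have s0 : s != ord0 by [].
have smax : ord_max != s.
  by rewrite -val_eqE /= /bump; have := ltn_ord t; lia.
rewrite (bigD1 ord0) // (bigD1 s) //= (bigD1 ord_max) /=; last by rewrite smax.
rewrite big1 => [|i /andP[/andP[i0 si] imax]]; last first.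
  suff [k ->] : exists k, i = C k by rewrite NwC mulr0.
  have [i1 ei1|ei] := unliftP ord0 i; last by rewrite ei eqxx in i0.
  have [i2 ei2|ei] := unliftP ord_max i1; last first.
    by rewrite ei1 ei -val_eqE /= /bump eqxx in imax.
  have [i3 ei3|ei] := unliftP t i2; last first.
    by rewrite ei1 ei2 ei eqxx in si.
  by exists i3; rewrite ei1 ei2 ei3.
have -> : bump 0 (bump q.+1 t) = t.+1 :> nat.
  by rewrite /bump; have := ltn_ord t; lia.
rewrite expr0 mul1r addr0 !exprS => sum0.
(* The surviving positions 0, [t.+1] and [q.+2] carry the signs 1, [- (-1) ^+ t] and [(-1) ^+ q], so
   only the term of [s] changes sides. *)
have {sum0} e : \det (row' s M) * ((-1) ^+ t * Nw s) =
    \det (row' ord0 M) * Nw ord0 + \det (row' ord_max M) * ((-1) ^+ q * Nw ord_max).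
  by apply/eqP; rewrite -subr_eq0 -oppr_eq0; apply/eqP; rewrite -[RHS]sum0; ring.
by rewrite -(pmulr_lgt0 _ Nws) e addr_gt0 // mulr_gt0.
Qed.

(* Induction on the dispersion of [f]: filling the first gap of [f] produces
   two row sets of smaller dispersion. *)
Lemma det_rows_gt0 q m n (A : 'M[R]_(m, n)) (g : 'I_q.+2 -> 'I_n) :
  (forall f : 'I_q.+1 -> 'I_m, {homo f : i j / (i < j)%N} ->
     0 < \det (mxsub f (g \o lift ord0) A)) ->
  (forall f : 'I_q.+2 -> 'I_m,
     (exists a : nat, forall i, f i = (a + i)%N :> nat) ->
     0 < \det (mxsub f g A)) ->
  forall f : 'I_q.+2 -> 'I_m, {homo f : i j / (i < j)%N} ->
    0 < \det (mxsub f g A).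
Proof.
move=> minor_gt0 contig_gt0 f.
have [d] := ubnP (f ord_max - f ord0)%N; elim: d f => // d IH f led hf.
(* [lift ord_max i] and [lift ord0 i] are the positions [i] and [i + 1]: without a gap the rows are
   consecutive. *)
case: (boolP [forall i : 'I_q.+1, f (lift ord0 i) == (f (lift ord_max i)).+1 :> nat]).
  move/forallP => succf; apply: contig_gt0; exists (f ord0) => -[i].
  elim: i => [|i IHi] lti; first by rewrite addn0; congr (val (f _)); apply/val_inj.
  have /eqP := succf (Ordinal (lti : (i < q.+1)%N)).
  rewrite [lift ord0 _](_ : _ = Ordinal lti); last exact/val_inj.
  have lti' : (i < q.+2)%N by apply: ltnW.
  rewrite [lift ord_max _](_ : _ = Ordinal lti'); last first.
    by apply/val_inj; rewrite /= /bump; move: lti; lia.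
  by move=> ->; rewrite IHi /= addnS.
rewrite negb_forall => /existsP[t gap].
have ltmax : (f (lift ord_max t) < f (lift ord0 t))%N.
  by apply: hf; rewrite /= /bump; have := ltn_ord t; lia.
have ltp : ((f (lift ord_max t)).+1 < m)%N.
  by apply: leq_ltn_trans (ltn_ord (f (lift ord0 t))).
(* [h] inserts, at position [t + 1], the first row missing from the gap; its end rows are those of
   [f]. *)
pose s : 'I_q.+3 := lift ord0 (lift ord_max t).
have sE : s = t.+1 :> nat by rewrite /= /bump; have := ltn_ord t; lia.
pose h := insert_at s (Ordinal ltp) f.
have lef : {homo f : i j / (i <= j)%N}.
  move=> i j; rewrite leq_eqVlt => /orP[/eqP/val_inj -> //|/hf]; exact: ltnW.
have hh : {homo h : i j / (i < j)%N}.
  apply: insert_at_homo => // k; rewrite sE => lek; rewrite /= .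
    by rewrite ltnS; apply: lef; rewrite /= /bump; have := ltn_ord t; move: lek; lia.
  have : (f (lift ord0 t) <= f k)%N by apply: lef; rewrite /= /bump; lia.
  by move: gap ltmax; lia.
have h0 : h ord0 = f ord0.
  transitivity (h (lift s ord0)); last exact: insert_at_lift.
  by congr h; apply/val_inj.
have lift_max_s : bump s q.+1 = q.+2 by rewrite /bump sE ltn_ord.
have hmax : h ord_max = f ord_max.
  transitivity (h (lift s ord_max)); last exact: insert_at_lift.
  by congr h; apply/val_inj; exact/esym.
have rowE i : row' i (mxsub h g A) = mxsub (h \o lift i) g A.
  by apply/matrixP => a b; rewrite !mxE.
have hhl i : {homo h \o lift i : a b / (a < b)%N}.
  by move=> a b ab; apply/hh/lift_homo.
have <- : row' s (mxsub h g A) = mxsub f g A.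
  by rewrite rowE; apply/matrixP => a b; rewrite !mxE /= /h insert_at_lift.
have lt0max : (f ord0 < f ord_max)%N by apply: hf.
(* Deleting row [s] of [h] gives [f]; deleting the first or the last row instead shrinks the
   dispersion, so [IH] applies. *)
apply: det_gap_gt0 => [k hk||].
- rewrite [mxsub _ _ _](_ : _ = mxsub (h \o k) (g \o lift ord0) A); last first.
    by apply/matrixP => a b; rewrite !mxE.
  by apply: minor_gt0 => a b ab; apply/hh/hk.
- rewrite rowE; apply: IH => //=.
  have -> : lift ord0 ord_max = ord_max :> 'I_q.+3 by apply/val_inj.
  have : (h ord0 < h (lift ord0 ord0))%N by apply: hh.
  by rewrite hmax h0; move: led lt0max; lia.
- rewrite rowE; apply: IH => //=.
  have -> : lift ord_max ord0 = ord0 :> 'I_q.+3 by apply/val_inj.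
  have : (h (lift ord_max ord_max) < h ord_max)%N.
    by apply: hh; rewrite /= /bump ltnn.
  have : (h ord0 < h (lift ord_max ord_max))%N.
    by apply: hh; rewrite /= /bump ltnn.
  by rewrite hmax h0; move: led lt0max; lia.
Qed.

End Gap.

(** * P-matrices and sign non-reversal *)

Section PMatrices.

Variable R : realFieldType.

(** The P-matrices; order [p = 0] is included and contributes the empty determinant 1. *)
Definition principal_minors_gt0 n (B : 'M[R]_n) :=
  forall p (f : 'I_p -> 'I_n), {homo f : i j / (i < j)%N} ->
    0 < \det (mxsub f f B).

(** A principal minor that avoids index [i] is unchanged; any other gains [t] times a smaller
    principal minor. *)
Lemma principal_minors_gt0_add_delta n (B : 'M[R]_n) i t :
  0 <= t -> principal_minors_gt0 B ->
  principal_minors_gt0 (B + t *: delta_mx i i).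
Proof.
move=> t0 PB p f hf.
have [/existsP[j /eqP fj]|/existsP nofj] := boolP [exists j, f j == i]; last first.
  rewrite [mxsub _ _ _](_ : _ = mxsub f f B); first exact: PB.
  apply/matrixP => a b; rewrite !mxE; have [fa|] := eqVneq (f a) i.
    by case: nofj; exists a; apply/eqP.
  by rewrite mulr0 addr0.
case: p => [|p] in f hf j fj *; first by case: j fj.
rewrite [mxsub _ _ _](_ : _ = mxsub f f B + t *: delta_mx j j); last first.
  by apply/matrixP => a b; rewrite !mxE -fj !(inj_eq (lt_homo_inj hf)).
rewrite det_add_diag ltr_wpDr //; last exact: PB.
apply: mulr_ge0 => //; rewrite ltW //.
rewrite [row' _ _](_ : _ = mxsub (f \o lift j) (f \o lift j) B).
  by apply: PB => a b ab; apply/hf/lift_homo.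
by apply/matrixP => a b; rewrite !mxE.
Qed.

Lemma det_add_diag_mx_gt0 n (B : 'M[R]_n) (d : 'rV[R]_n) :
  (forall i, 0 <= d 0 i) -> principal_minors_gt0 B ->
  0 < \det (B + diag_mx d).
Proof.
move=> d0 PB; rewrite diag_mx_sum_delta.
have {PB} /(_ n id (fun _ _ => id)) : principal_minors_gt0 (B + \sum_i d 0 i *: delta_mx i i).
  elim: (index_enum _) => [|i l IH]; first by rewrite big_nil addr0.
  rewrite big_cons addrCA addrC; exact: principal_minors_gt0_add_delta.
by rewrite mxsub_id.
Qed.

(* If [x] has full support and [B] reverses its signs, then [x] lies in the
   kernel of [B + D] for a nonnegative diagonal matrix [D]. *)
Lemma principal_minors_gt0_sign_nonreversal n (B : 'M[R]_n) (x : 'cV[R]_n) :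
  principal_minors_gt0 B -> x != 0 -> exists i, 0 < x i 0 * (B *m x) i 0.
Proof.
elim: n B x => [|n IH] B x PB x0; first by rewrite flatmx0 eqxx in x0.
(* A zero coordinate is removed together with its row and column, which leaves the other products
   unchanged. *)
have [/existsP[j /eqP xj]|/negP nox] := boolP [exists j, x j 0 == 0].
  have xE (k : 'I_n.+1) : (B *m x) k 0 = \sum_(l < n) B k (lift j l) * x (lift j l) 0.
    by rewrite mxE (bigD1_ord j) //= xj mulr0 add0r.
  have [||i] := IH (row' j (col' j B)) (row' j x).
  - move=> p f hf.
    rewrite [mxsub _ _ _](_ : _ = mxsub (lift j \o f) (lift j \o f) B).
      by apply: PB => a b ab; apply/lift_homo/hf.
    by apply/matrixP => a b; rewrite !mxE.
  - apply: contra_neq x0 => xj0; apply/colP => i; rewrite mxE.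
    have [k ->|->//] := unliftP j i.
    by have /colP/(_ k) := xj0; rewrite !mxE.
  - exists (lift j i); rewrite xE; congr (_ < _): p; rewrite !mxE; congr (_ * _).
    by apply: eq_bigr => l _; rewrite !mxE.
have xn0 i : x i 0 != 0 by apply/negP => xi; apply: nox; apply/existsP; exists i.
have [/existsP[i hi]|/negP noi] := boolP [exists i, 0 < x i 0 * (B *m x) i 0].
  by exists i.
(* Chosen to solve [(B *m x) i 0 + d 0 i * x i 0 = 0]; nonnegative because no product
   [x i 0 * (B *m x) i 0] is positive. *)
pose d : 'rV[R]_n.+1 := \row_i (- (B *m x) i 0 / x i 0).
have d0 i : 0 <= d 0 i.
  have x2 : 0 < x i 0 ^+ 2 by rewrite lt0r sqrf_eq0 xn0 sqr_ge0.
  rewrite -(pmulr_rge0 (d 0 i) x2) [d 0 i]mxE.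
  rewrite (_ : x i 0 ^+ 2 * _ = - (x i 0 * (B *m x) i 0)).
    rewrite oppr_ge0 leNgt; apply/negP => hi; apply: noi.
    by apply/existsP; exists i.
  by field; exact: xn0.
have := det_add_diag_mx_gt0 d0 PB.
have Dx : (B + diag_mx d) *m x = 0.
  apply/colP => i; rewrite mulmxDl mul_diag_mx mxE [X in _ + X]mxE [d _ _]mxE.
  by rewrite divfK // subrr mxE.
rewrite lt0r => /andP[+ _].
rewrite -unitfE -unitmxE => unit_BD.
by rewrite -(mulKmx unit_BD x) Dx mulmx0 eqxx in x0.
Qed.

End PMatrices.

(** * Submatrices and Fekete's criterion *)

Section TotalPositivity.

Variable R : realType.
Implicit Types (m n p q r k : nat).

Lemma mxsub_submatrix m n p q (A : 'M[R]_(m, n)) (f : 'I_p -> 'I_m) (g : 'I_q -> 'I_n) :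
  {homo f : i j / (i < j)%N} -> {homo g : i j / (i < j)%N} ->
  submatrix A (mxsub f g A).
Proof. by move=> hf hg; exists f, g. Qed.

Lemma contiguous_submatrixW m n p q (A : 'M[R]_(m, n)) (B : 'M[R]_(p, q)) :
  contiguous_submatrix A B -> submatrix A B.
Proof.
move=> [f [g [[a fE] [b gE] ->]]]; apply: mxsub_submatrix => i j ij.
  by rewrite !fE ltn_add2l.
by rewrite !gE ltn_add2l.
Qed.

Lemma submatrix_trans m n p q p' q' (A : 'M[R]_(m, n)) (B : 'M[R]_(p, q))
    (C : 'M[R]_(p', q')) :
  submatrix A B -> submatrix B C -> submatrix A C.
Proof.
move=> [f [g [hf hg ->]]] [f' [g' [hf' hg' ->]]]; exists (f \o f'), (g \o g').
split; [by move=> i j ij; apply/hf/hf' | by move=> i j ij; apply/hg/hg'|].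
by apply/matrixP => i j; rewrite !mxE.
Qed.

Lemma tp_principal_minors_gt0 k m n r (A : 'M[R]_(m, n)) (B : 'M[R]_r) :
  totally_positive k A -> (r <= k)%N -> submatrix A B ->
  principal_minors_gt0 B.
Proof.
move=> tpA rk AB [|p] f hf; first by rewrite det_mx00 ltr01.
apply: (tpA p.+1); last by apply: submatrix_trans AB _; apply: mxsub_submatrix.
apply: leq_trans rk.
by have := leq_card f (lt_homo_inj hf); rewrite !card_ord.
Qed.

(** [det_rows_gt0] reduces arbitrary rows to consecutive ones; applied to the transpose, it then
    does the same for columns. *)
Lemma tp_succ k m n (A : 'M[R]_(m, n)) :
  totally_positive k A ->
  (forall B : 'M[R]_k.+1, contiguous_submatrix A B -> 0 < \det B) ->
  totally_positive k.+1 A.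
Proof.
move=> tpA contig_gt0 r B /andP[r0].
rewrite leq_eqVlt => /orP[/eqP rk|rk]; last by apply: tpA; rewrite r0.
subst r; move=> [f [g [hf hg ->]]].
case: k => [|q] in tpA contig_gt0 f g hf hg {B r0} *.
  apply: contig_gt0; exists f, g; split=> //.
    by exists (f ord0) => i; rewrite ord1 addn0.
  by exists (g ord0) => i; rewrite ord1 addn0.
have minor_gt0 (f' : 'I_q.+1 -> 'I_m) (g' : 'I_q.+1 -> 'I_n) : {homo f' : i j / (i < j)%N} ->
    {homo g' : i j / (i < j)%N} -> 0 < \det (mxsub f' g' A).
  by move=> hf' hg'; apply: (tpA q.+1); [rewrite leqnn | apply: mxsub_submatrix].
apply: det_rows_gt0 => // [f' hf'|{hf}f contig_f].
  by apply: minor_gt0 => // i j ij; apply/hg/lift_homo.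
have trE (f' : 'I_q.+2 -> _) (g' : 'I_q.+2 -> _) :
    \det (mxsub f' g' A) = \det (mxsub g' f' A^T).
  by rewrite -trmx_mxsub det_tr.
rewrite trE; apply: det_rows_gt0 => // [g' hg'|g' contig_g].
  rewrite -trmx_mxsub det_tr; apply: minor_gt0 => // i j ij.
  have [a fE] := contig_f.
  by rewrite !fE ltn_add2l lift_homo.
by rewrite -trE; apply: contig_gt0; exists f, g'.
Qed.

(** * Alternating vectors and the vector [zvec] *)

Lemma sqr_alt_vec r (i : 'I_r) : alt_vec R r i 0 * alt_vec R r i 0 = 1.
Proof. by rewrite mxE -expr2 sqrr_sign. Qed.

Lemma R_alt_scale_alt_vec r (x : 'cV[R]_r) :
  (forall i, 0 < alt_vec R r i 0 * x i 0) -> R_alt R r x.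
Proof.
move=> xd; split=> [i|i j ij].
  by apply: contraTneq (xd i) => ->; rewrite mulr0 ltxx.
rewrite -oppr_gt0; have := mulr_gt0 (xd i) (xd j).
by rewrite !mxE ij exprS mulN1r mulNr mulrN mulrACA -expr2 sqrr_sign mul1r.
Qed.

(** The signs of [alt_vec] cancel the cofactor signs, so positive minors make
    [\adj B *m alt_vec R r] alternate. *)
Lemma alt_vec_adj r (B : 'M[R]_r) (i : 'I_r) :
  alt_vec R r i 0 * (\adj B *m alt_vec R r) i 0 =
  \sum_j \det (row' j (col' i B)).
Proof.
rewrite !mxE mulr_sumr; apply: eq_bigr => j _.
rewrite !mxE /cofactor exprD.
have := sqrr_sign R i; have := sqrr_sign R j; rewrite !expr2 => ej ei.
by ring: ei ej.
Qed.

Lemma mul_zvec r (B : 'M[R]_r) : B *m zvec B = \det B ^+ 2 *: alt_vec R r.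
Proof.
by rewrite /zvec -scalemxAr mulmxA mul_mx_adj mul_scalar_mx scalerA.
Qed.

(* Where [z = zvec B] violates the claim, [z] and [alt_vec] have opposite signs
   or [z] vanishes, so [e *: alt_vec - z] alternates strictly for all [e > 0]. *)
Lemma sign_nonreversal_zvec r (B : 'M[R]_r) :
  sign_nonreversal B (R_alt R r) ->
  nonstrict_sign_nonreversal B [set zvec B]%classic.
Proof.
move=> nrB z -> z0; set d := alt_vec R r; have BzE := mul_zvec B.
have detB : \det B != 0.
  by apply: contra_neq z0 => detB; rewrite /zvec detB scale0r.
have [/existsP[i /andP[zi hi]]|/negP nex] :=
    boolP [exists i, (zvec B i 0 != 0) && (0 <= zvec B i 0 * (B *m zvec B) i 0)].
  by exists i.
have det2 : 0 < \det B ^+ 2 by rewrite lt0r sqrf_eq0 detB sqr_ge0.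
have zd i : 0 <= - (d i 0 * zvec B i 0).
  have [->|zi] := eqVneq (zvec B i 0) 0; first by rewrite mulr0 oppr0.
  rewrite oppr_ge0 leNgt; apply/negP => hi; apply: nex; apply/existsP; exists i.
  by rewrite zi BzE [X in _ * X]mxE mulrCA mulr_ge0 ?ltW // mulrC.
(* [c] strictly bounds every [(B *m d) i 0 * d i 0], so with [e = \det B ^+ 2 / c] the vector
   [B *m x] keeps the signs of [- d], while [x] has those of [d]. *)
pose c := 1 + \sum_i `|(B *m d) i 0|.
have c0 : 0 < c by rewrite ltr_pwDl // sumr_ge0.
have ltc i : (B *m d) i 0 * d i 0 < c.
  apply: le_lt_trans (ler_norm _) _; rewrite normrM [d i 0]mxE normrX normrN1 expr1n mulr1.
  rewrite /c (bigD1 i) //= addrCA -[ltLHS]addr0 ltrD2l.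
  by rewrite ltr_pwDl // sumr_ge0.
pose e := \det B ^+ 2 / c.
have e0 : 0 < e by rewrite divr_gt0.
pose x := e *: d - zvec B.
have xd i : 0 < d i 0 * x i 0.
  rewrite [x i 0]mxE [X in X + _]mxE [X in _ + X]mxE mulrDr mulrN ltr_pwDl //.
  by rewrite mulrCA sqr_alt_vec mulr1.
have xalt : R_alt R r x by exact: R_alt_scale_alt_vec.
have x0 : x != 0.
  apply: contra_neq z0 => x0; apply/colP => i.
  by have := xd i; rewrite x0 [X in _ * X]mxE mulr0 ltxx.
have [i] := nrB x xalt x0.
have -> : x i 0 * (B *m x) i 0 = (d i 0 * x i 0) * (d i 0 * (B *m x) i 0).
  by rewrite mulrACA sqr_alt_vec mul1r.
have -> : (B *m x) i 0 = e * (B *m d) i 0 - \det B ^+ 2 * d i 0.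
  rewrite mulmxBr BzE -scalemxAr [LHS]mxE [X in X + _]mxE [X in _ + X]mxE.
  by congr (_ - _); exact: mxE.
rewrite pmulr_rgt0 //.
rewrite mulrBr [X in _ - X]mulrCA sqr_alt_vec mulr1 mulrCA subr_gt0.
rewrite /e mulrAC ltr_pdivlMr // ltr_pM2l // mulrC => h.
by have := lt_trans h (ltc i); rewrite ltxx.
Qed.

(** With [y = \adj B *m d] and [z = zvec B], one has [B *m y = \det B *: d], which excludes a zero
    determinant, and [z_i (B z)_i = det(B)^3 d_i y_i] with [d_i y_i > 0], which fixes its sign. *)
Lemma contiguous_det_gt0 r (B : 'M[R]_r.+1) :
  totally_positive r B ->
  (forall x : 'cV[R]_r.+1, R_alt R r.+1 x -> B *m x != 0) ->
  nonstrict_sign_nonreversal B [set zvec B]%classic ->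
  0 < \det B.
Proof.
move=> tpB nz nr; set d := alt_vec R r.+1.
have minor_gt0 i j : 0 < \det (row' j (col' i B)).
  have BB : submatrix B (row' j (col' i B)).
    exists (lift j), (lift i); split; try exact: lift_homo.
    by apply/matrixP => a b; rewrite !mxE.
  (* For [r = 0] the minor is the empty determinant 1, on which total positivity of order 0 is
     silent. *)
  case: r B tpB {nz nr d} i j BB => [|q] B tpB i j BB; first by rewrite det_mx00.
  by apply: tpB BB; rewrite leqnn.
pose y := \adj B *m d.
have dy i : 0 < d i 0 * y i 0.
  rewrite alt_vec_adj (bigD1 ord0) //= ltr_pwDl // sumr_ge0 // => j _.
  exact: ltW.
have By : B *m y = \det B *: d by rewrite mulmxA mul_mx_adj mul_scalar_mx.
have detB : \det B != 0.
  apply: contra_neq (nz y (R_alt_scale_alt_vec dy)) => detB.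
  by rewrite By detB scale0r.
have z0 : zvec B != 0.
  rewrite /zvec -/d -/y scaler_eq0 negb_or detB /=; apply: contraTneq (dy ord0) => ->.
  by rewrite [X in _ * X]mxE mulr0 ltxx.
have [i [_]] := nr _ erefl z0.
have zE : zvec B i 0 = \det B * y i 0 by exact: mxE.
have BzE : (B *m zvec B) i 0 = \det B ^+ 2 * d i 0.
  by rewrite mul_zvec; exact: mxE.
have -> : zvec B i 0 * (B *m zvec B) i 0 =
    \det B ^+ 2 * (\det B * (d i 0 * y i 0)) by rewrite zE BzE; ring.
rewrite pmulr_rge0; last by rewrite lt0r sqrf_eq0 detB sqr_ge0.
by rewrite pmulr_lge0 // le0r (negbTE detB).
Qed.

End TotalPositivity.

Theorem theoremA (R : realType) (m n k : nat) (hk : (1 <= k)%N)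
    (hm : (k <= m)%N) (hn : (k <= n)%N) (A : 'M[R]_(m, n)) :
  [<-> totally_positive k A;
       forall (r : nat) (B : 'M[R]_r),
         (1 <= r <= k)%N -> submatrix A B ->
         sign_nonreversal B setT;
       forall (r : nat) (B : 'M[R]_r),
         (1 <= r <= k)%N -> contiguous_submatrix A B ->
         sign_nonreversal B (R_alt R r);
       forall (r : nat) (B : 'M[R]_r),
         (1 <= r <= k)%N -> contiguous_submatrix A B ->
         (forall x : 'cV[R]_r, R_alt R r x -> B *m x != 0) /\
         nonstrict_sign_nonreversal B [set zvec B]%classic].
Proof.
tfae.
- move=> tpA r B /andP[_ rk] AB x _.
  exact/principal_minors_gt0_sign_nonreversal/(tp_principal_minors_gt0 tpA).
- move=> nrA r B rk /contiguous_submatrixW AB x _.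
  exact: nrA.
- move=> nrA r B rk AB; have nrB := nrA r B rk AB; split; last first.
    exact: sign_nonreversal_zvec.
  move=> x altx; apply: contraTneq isT => Bx.
  have [||i] := nrB x => //.
    (* Since [1 <= r], an alternating vector has an entry at index 0, and it is nonzero. *)
    case/andP: rk => r0 _; have [xn0 _] := altx.
    by apply: contra_neq (xn0 (Ordinal r0)) => ->; rewrite mxE.
  by rewrite Bx mxE mulr0 ltxx.
- move=> H.
  (* Minors of a contiguous [B] of order at most [r] are minors of [A], hence positive by
     induction. *)
  have tp r : (r <= k)%N -> totally_positive r A.
    elim: r => [_ r B|r IH rk]; first by case: r B.
    apply: tp_succ (IH (ltnW rk)) _ => B AB; have [nz nr] := H r.+1 B rk AB.
    apply: contiguous_det_gt0 => // p C hp BC; apply: (IH (ltnW rk)) => //.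
    exact: submatrix_trans (contiguous_submatrixW AB) BC.
  exact: tp.
Qed.
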